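(* For every positive integer $\ell$ and $|q|<1$, $$\sum_{n=\ell}^\infty\frac{q^{\binom{\ell}{2}+(\ell+1)n}}{(q;q)_n}\begin{bmatrix}n-1\\ \ell-1\end{bmatrix}=q^{\frac32\ell^2+\frac12\ell}\sum_{n=0}^\infty\frac{q^{(2\ell+1)n+n^2}(1-q^\ell)}{(q;q)_n(q;q)_{n+2\ell}(1-q^{n+\ell})}.$$
   Context: $(a;q)_n=\prod_{m=0}^{n-1}(1-aq^m)$ with $(a;q)_0=1$. The Gaussian polynomial is $\begin{bmatrix}n\\k\end{bmatrix}=\dfrac{(q;q)_n}{(q;q)_k(q;q)_{n-k}}$ for $0\le k\le n$, and $0$ if $k<0$ or $k>n$. *)

(* Defs.v *)
From Stdlib Require Import Reals.
From Coquelicot Require Import Coquelicot.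
From mathcomp Require binomial.

Open Scope C_scope.

(* (a; q)_n *)
Fixpoint qpoch (a q : C) (n : nat) : C :=
  match n with
  | O => 1
  | S m => qpoch a q m * (1 - a * q ^ m)
  end.

(* Only natural indices occur, so the convention "0 if k < 0" is not needed. *)
Definition gauss_binom (q : C) (n k : nat) : C :=
  if Nat.leb k n
  then qpoch q q n / (qpoch q q k * qpoch q q (n - k))
  else 0.

(* The series a m + a (m+1) + a (m+2) + ... converges to s. *)
Definition is_series_from (m : nat) (a : nat -> C) (s : C) : Prop :=
  is_series (fun k : nat => a (m + k)%nat) s.

(* Main.v *)
Require Import Defs.
From Stdlib Require Import Reals Lra Lia.
From Coquelicot Require Import Coquelicot.
From mathcomp Require binomial.

(** Put n = l + k on the left: up to the power of q in front, the series becomes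
    that of 2phi1(a, 0; c; q, z) divided by (q;q)_l, for a = q^l and
    c = z = q^(l+1).  The right-hand series comes from the case b -> 0 of
    Jackson's transformation,
    [2phi1(a, 0; c; q, z) = (az;q)_oo / (z;q)_oo *
       sum_n (a)_n q^(n(n-1)) (cz)^n / ((q)_n (c)_n (az)_n)],
    where the quotient (a)_n / (c)_n with c = aq collapses to
    (1 - a) / (1 - a q^n), and az = q^(2l+1) completes (q;q)_(2l) to
    (q;q)_(n+2l).

    Since a = q^l with l a natural number, the infinite products reduce to the
    polynomial (z;q)_l, and the transformation can be proved by induction on l
    without interchanging any double sum.

    - Induction step: both sides satisfy
      [(1 - a) F(aq; z) = F(a; z) - a F(a; zq)], and they do so term by term
      ([phi_term_contiguous], [jackson_term_contiguous]).  This recurrence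
      moves z but not c, so c is fixed and z is universally quantified.
    - Base case a = q, where [qpoch q q n] cancels: the identity of Rogers-Fine
      type [(1 - z) sum_k z^k/(c)_k = sum_n q^(n(n-1)) (cz)^n/((c)_n (zq)_n)]
      ([rogers_fine_special]).  With g(c, z) for the left-hand side, subtracting
      z times the series from its shift gives
      [g(c, z) = 1 + cz / ((1-c)(1-zq)) g(cq, zq)].  Iterating produces the
      right-hand terms one by one, and the remainder after n steps is
      O(|cz|^n), because the sums at (c q^n, z q^n) are bounded uniformly
      in n. *)

Open Scope C_scope.

(** * Finite q-shifted factorials *)

Lemma one_minus_neq_0 (x : C) : (Cmod x < 1)%R -> 1 - x <> 0.
Proof.
  intros Hx H.
  assert (E : x = 1).
  { replace x with (1 - (1 - x)) by ring. rewrite H. ring. }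
  rewrite E, Cmod_1 in Hx. lra.
Qed.

Lemma pow_le_1 (r : R) (n : nat) : (0 <= r <= 1)%R -> (r ^ n <= 1)%R.
Proof.
  intros Hr. rewrite <- (pow1 n). now apply pow_incr.
Qed.

Lemma Cmod_mult_pow_le (c q : C) (n : nat) :
  (Cmod q < 1)%R -> (Cmod (c * q ^ n) <= Cmod c)%R.
Proof.
  intros Hq. rewrite Cmod_mult, Cmod_pow.
  assert (H := Cmod_ge_0 c). assert (H' := Cmod_ge_0 q).
  assert (Cmod q ^ n <= 1)%R by (apply pow_le_1; lra).
  nra.
Qed.

Lemma Cmod_pow_lt_1 (q : C) (n : nat) :
  (Cmod q < 1)%R -> (Cmod (q ^ S n) < 1)%R.
Proof.
  intros Hq. rewrite Cpow_S.
  apply Rle_lt_trans with (2 := Hq). now apply Cmod_mult_pow_le.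
Qed.

Lemma qpoch_shift (a q : C) (n : nat) :
  qpoch a q (S n) = (1 - a) * qpoch (a * q) q n.
Proof.
  induction n as [|n IH].
  - simpl. ring.
  - change (qpoch a q (S (S n))) with (qpoch a q (S n) * (1 - a * q ^ S n)).
    rewrite IH. simpl. ring.
Qed.

Lemma qpoch_add (a q : C) (m n : nat) :
  qpoch a q (m + n) = qpoch a q m * qpoch (a * q ^ m) q n.
Proof.
  induction n as [|n IH].
  - rewrite Nat.add_0_r. simpl. ring.
  - rewrite Nat.add_succ_r. simpl. rewrite IH, Cpow_add_r. ring.
Qed.

Lemma qpoch_neq_0 (a q : C) (n : nat) :
  (Cmod a < 1)%R -> (Cmod q < 1)%R -> qpoch a q n <> 0.
Proof.
  intros Ha Hq. induction n as [|n IH]; simpl.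
  - apply C1_nz.
  - apply Cmult_neq_0; [exact IH|]. apply one_minus_neq_0.
    apply Rle_lt_trans with (2 := Ha). now apply Cmod_mult_pow_le.
Qed.

Lemma Cmod_inv_one_minus_le (x : C) (rho : R) :
  (rho < 1)%R -> (Cmod x <= rho)%R ->
  (Cmod (/ (1 - x)) <= exp (Cmod x / (1 - rho)))%R.
Proof.
  intros Hrho Hx.
  assert (H0 := Cmod_ge_0 x).
  rewrite Cmod_inv by (apply one_minus_neq_0; lra).
  assert (Ht : (1 - Cmod x <= Cmod (1 - x))%R).
  { assert (H := Cmod_triangle (1 - x) x).
    replace (1 - x + x) with (RtoC 1) in H by ring.
    rewrite Cmod_1 in H. lra. }
  apply Rle_trans with (/ (1 - Cmod x))%R.
  { apply Rinv_le_contravar; lra. }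
  apply Rle_trans with (1 + Cmod x / (1 - rho))%R.
  - apply Rle_trans with (1 + Cmod x / (1 - Cmod x))%R.
    + apply Req_le. field. lra.
    + apply Rplus_le_compat_l. apply Rmult_le_compat_l; [exact H0|].
      apply Rinv_le_contravar; lra.
  - apply exp_ineq1_le.
Qed.

(** The product of the factors 1/(1 - c q^i) is at most the exponential of the
    geometric sum of the |q|^i / (1 - rho).  The bound is uniform in c because
    it will be applied to all the c q^N at once. *)
Lemma inv_qpoch_bounded (q : C) (rho : R) :
  (Cmod q < 1)%R -> (rho < 1)%R ->
  exists B : R, forall (c : C) (n : nat),
    (Cmod c <= rho)%R -> (Cmod (/ qpoch c q n) <= B)%R.
Proof.
  intros Hq Hrho.
  set (r := Cmod q) in *. assert (Hr : (0 <= r)%R) by apply Cmod_ge_0.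
  exists (exp (/ (1 - rho) / (1 - r))). intros c n Hc.
  assert (Hc1 : (Cmod c < 1)%R) by lra.
  assert (Hk : (0 < / (1 - rho))%R) by (apply Rinv_0_lt_compat; lra).
  assert (Hs : (0 < / (1 - r))%R) by (apply Rinv_0_lt_compat; lra).
  apply Rle_trans with (exp (/ (1 - rho) * ((1 - r ^ n) / (1 - r)))).
  - induction n as [|n IH].
    + simpl. replace (/ 1) with (RtoC 1) by (field; apply C1_nz).
      rewrite Cmod_1. replace (/ (1 - rho) * ((1 - 1) / (1 - r)))%R with 0%R
        by (field; lra).
      rewrite exp_0. lra.
    + assert (Hx : (Cmod (c * q ^ n) <= rho)%R).
      { apply Rle_trans with (2 := Hc). now apply Cmod_mult_pow_le. }
      assert (Hn : 1 - c * q ^ n <> 0) by (apply one_minus_neq_0; lra).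
      assert (Hp : qpoch c q n <> 0) by (now apply qpoch_neq_0).
      simpl qpoch.
      replace (/ (qpoch c q n * (1 - c * q ^ n)))
        with (/ qpoch c q n * / (1 - c * q ^ n)) by (field; auto).
      rewrite Cmod_mult.
      replace (/ (1 - rho) * ((1 - r ^ S n) / (1 - r)))%R
        with (/ (1 - rho) * ((1 - r ^ n) / (1 - r)) + r ^ n / (1 - rho))%R
        by (simpl; field; lra).
      rewrite exp_plus.
      apply Rmult_le_compat; try apply Cmod_ge_0; [exact IH|].
      eapply Rle_trans; [exact (Cmod_inv_one_minus_le _ _ Hrho Hx)|].
      assert (He : (Cmod (c * q ^ n) <= r ^ n)%R).
      { rewrite Cmod_mult, Cmod_pow. fold r.
        rewrite <- (Rmult_1_l (r ^ n)) at 2.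
        apply Rmult_le_compat_r; [now apply pow_le|lra]. }
      destruct He as [He|He].
      * left. apply exp_increasing. now apply Rmult_lt_compat_r.
      * rewrite He. apply Rle_refl.
  - assert (He : (/ (1 - rho) * ((1 - r ^ n) / (1 - r))
                  <= / (1 - rho) / (1 - r))%R).
    { apply Rmult_le_compat_l; [lra|].
      assert (0 <= r ^ n)%R by now apply pow_le.
      apply Rle_trans with (1 / (1 - r))%R; [|right; field; lra].
      apply Rmult_le_compat_r; lra. }
    destruct He as [He|He].
    + left. now apply exp_increasing.
    + rewrite He. apply Rle_refl.
Qed.

(** * Complex series *)

Lemma is_series_C_unique (u : nat -> C) (s s' : C) :
  is_series u s -> is_series u s' -> s = s'.
Proof. apply filterlim_locally_unique. Qed.

(** Stating the pointwise equality in [C], rather than in the carrier of a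
    normed module, lets [ring] and [field] recognize it. *)
Lemma is_series_C_ext (u v : nat -> C) (s : C) :
  (forall n, u n = v n) -> is_series u s -> is_series v s.
Proof. exact (is_series_ext u v s). Qed.

Lemma is_series_of_remainder (u : nat -> C) (s : C) (e : nat -> R) :
  (forall n, (Cmod (sum_n u n - s) <= e n)%R) -> is_lim_seq e 0 ->
  is_series u s.
Proof.
  intros Hu He. apply filterlim_locally_ball_norm. intros eps.
  apply is_lim_seq_spec in He. specialize (He eps).
  revert He. apply filter_imp. intros n Hn.
  unfold ball_norm. change (Cmod (sum_n u n - s) < eps)%R.
  eapply Rle_lt_trans; [apply Hu|].
  rewrite Rminus_0_r in Hn. eapply Rle_lt_trans; [apply Rle_abs|exact Hn].
Qed.

Lemma series_geom_le (u : nat -> C) (B w : R) :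
  (0 <= w < 1)%R -> (forall n, (Cmod (u n) <= B * w ^ n)%R) ->
  exists s, is_series u s /\ (Cmod s <= B / (1 - w))%R.
Proof.
  intros Hw Hu.
  assert (Hg : is_series (fun n => B * w ^ n)%R (B / (1 - w))%R).
  { apply (is_series_scal (K := R_AbsRing) (V := R_NormedModule)).
    apply is_series_geom. rewrite Rabs_pos_eq; lra. }
  destruct (ex_series_le (V := C_CompleteNormedModule) u
              (fun n => B * w ^ n)%R) as [s Hs].
  { intros n. exact (Hu n). }
  { eexists; exact Hg. }
  exists s. split; [exact Hs|].
  apply (is_lim_seq_le (fun n => Cmod (sum_n u n)) (sum_n (fun n => B * w ^ n)%R)
           (Cmod s) (B / (1 - w))%R).
  - intros n. eapply Rle_trans; [exact (norm_sum_n_m u 0 n)|].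
    apply sum_n_m_le. exact Hu.
  - exact (filterlim_comp _ _ _ _ _ _ _ _ Hs (filterlim_norm s)).
  - exact Hg.
Qed.

(** * The base case: an identity of Rogers-Fine type *)

Definition fine_term (c q z : C) (n : nat) : C :=
  q ^ (n * (n - 1)) * (c * z) ^ n / (qpoch c q n * qpoch (z * q) q n).

Lemma geom_qpoch_series (q : C) (rho : R) :
  (Cmod q < 1)%R -> (0 <= rho < 1)%R ->
  exists M : R, forall c z : C, (Cmod c <= rho)%R -> (Cmod z <= rho)%R ->
    exists s : C,
      is_series (fun k => z ^ k / qpoch c q k) s /\ (Cmod s <= M)%R.
Proof.
  intros Hq Hrho.
  destruct (inv_qpoch_bounded q rho Hq (proj2 Hrho)) as [B HB].
  exists (B / (1 - rho))%R. intros c z Hc Hz.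
  apply series_geom_le; [exact Hrho|].
  intros n. unfold Cdiv. rewrite Cmod_mult, Cmod_pow, Rmult_comm.
  apply Rmult_le_compat; try apply Cmod_ge_0.
  - apply pow_le, Cmod_ge_0.
  - now apply HB.
  - apply pow_incr. split; [apply Cmod_ge_0|exact Hz].
Qed.

(** The series is compared with its own shift:
    [z^(k+1)/(c)_(k+1) - z * z^k/(c)_k] equals
    [cz/(1-c) * (zq)^k/(cq)_k], because [1 - (1 - c q^k) = c q^k]. *)
Lemma geom_qpoch_step (q c z s s' : C) :
  (Cmod q < 1)%R -> (Cmod c < 1)%R ->
  is_series (fun k => z ^ k / qpoch c q k) s ->
  is_series (fun k => (z * q) ^ k / qpoch (c * q) q k) s' ->
  (1 - z) * s = 1 + c * z / (1 - c) * s'.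
Proof.
  intros Hq Hc Hs Hs'.
  assert (Hc' : (Cmod (c * q) < 1)%R).
  { apply Rle_lt_trans with (2 := Hc).
    rewrite <- (Cpow_1_r q). now apply Cmod_mult_pow_le. }
  assert (H1 : is_series (fun k => z ^ S k / qpoch c q (S k)) (s - 1)).
  { apply (is_series_incr_1 (fun k => z ^ k / qpoch c q k)).
    replace (plus _ _) with s; [exact Hs|].
    change (s = s - 1 + 1 / 1). field. }
  assert (H2 := is_series_minus _ _ _ _ H1
                  (is_series_scal (V := C_NormedModule) z _ _ Hs)).
  assert (H3 := is_series_scal (V := C_NormedModule) (c * z / (1 - c)) _ _ Hs').
  apply (is_series_C_ext _ (fun k => c * z / (1 - c) *
           ((z * q) ^ k / qpoch (c * q) q k))) in H2.
  - assert (E := is_series_C_unique _ _ _ H2 H3).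
    change (s - 1 - z * s = c * z / (1 - c) * s') in E.
    rewrite <- E. ring.
  - intros k.
    change (z ^ S k / qpoch c q (S k) - z * (z ^ k / qpoch c q k)
            = c * z / (1 - c) * ((z * q) ^ k / qpoch (c * q) q k)).
    assert (Hp : qpoch (c * q) q k <> 0) by now apply qpoch_neq_0.
    assert (Hp' : qpoch c q k <> 0) by now apply qpoch_neq_0.
    assert (Hk : 1 - c * q ^ k <> 0).
    { apply one_minus_neq_0, Rle_lt_trans with (2 := Hc).
      now apply Cmod_mult_pow_le. }
    assert (H0 : 1 - c <> 0) by now apply one_minus_neq_0.
    assert (E : qpoch (c * q) q k = qpoch c q k * (1 - c * q ^ k) / (1 - c)).
    { change (qpoch c q k * (1 - c * q ^ k)) with (qpoch c q (S k)).
      rewrite qpoch_shift. field. exact H0. }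
    rewrite E, Cpow_mult_l. simpl. field. auto.
Qed.

(** One step of the iteration.  The factor cz / ((1-c)(1-zq)) of the functional
    equation, taken at (c q^n, z q^n), is the ratio of consecutive
    [fine_term]s. *)
Lemma fine_term_step (q c z s s' : C) (n : nat) :
  (Cmod q < 1)%R -> (Cmod c < 1)%R -> (Cmod z < 1)%R ->
  is_series (fun k => (z * q ^ n) ^ k / qpoch (c * q ^ n) q k) s ->
  is_series (fun k => (z * q ^ S n) ^ k / qpoch (c * q ^ S n) q k) s' ->
  fine_term c q z n * ((1 - z * q ^ n) * s)
  = fine_term c q z n + fine_term c q z (S n) * ((1 - z * q ^ S n) * s').
Proof.
  intros Hq Hc Hz Hs Hs'.
  assert (Hcn : (Cmod (c * q ^ n) < 1)%R).
  { apply Rle_lt_trans with (2 := Hc). now apply Cmod_mult_pow_le. }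
  rewrite (geom_qpoch_step q (c * q ^ n) (z * q ^ n) s s' Hq Hcn Hs).
  2:{ revert Hs'. apply is_series_C_ext. intros k.
      replace (z * q ^ S n) with (z * q ^ n * q) by (simpl; ring).
      replace (c * q ^ S n) with (c * q ^ n * q) by (simpl; ring).
      reflexivity. }
  unfold fine_term.
  replace (S n * (S n - 1))%nat with (n * (n - 1) + (n + n))%nat
    by (destruct n; simpl; lia).
  assert (Hzn : (Cmod (z * q) < 1)%R).
  { apply Rle_lt_trans with (2 := Hz).
    rewrite <- (Cpow_1_r q). now apply Cmod_mult_pow_le. }
  assert (H1 := qpoch_neq_0 c q n Hc Hq).
  assert (H2 := qpoch_neq_0 (z * q) q n Hzn Hq).
  assert (H3 : 1 - c * q ^ n <> 0) by now apply one_minus_neq_0.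
  assert (H4 : 1 - z * q * q ^ n <> 0).
  { apply one_minus_neq_0, Rle_lt_trans with (2 := Hzn).
    now apply Cmod_mult_pow_le. }
  rewrite !Cpow_add_r. simpl. field.
  replace (z * (q * q ^ n)) with (z * q * q ^ n) by ring. auto.
Qed.

(** No choice of the intermediate sums is made: each step obtains the one that
    it needs from [geom_qpoch_series], and it cancels from the final formula. *)
Lemma fine_partial_sum (q c z s s' : C) (n : nat) :
  (Cmod q < 1)%R -> (Cmod c < 1)%R -> (Cmod z < 1)%R ->
  is_series (fun k => z ^ k / qpoch c q k) s ->
  is_series (fun k => (z * q ^ S n) ^ k / qpoch (c * q ^ S n) q k) s' ->
  (1 - z) * s
  = sum_n (fine_term c q z) n
    + fine_term c q z (S n) * ((1 - z * q ^ S n) * s').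
Proof.
  intros Hq Hc Hz Hs. revert s'. induction n as [|n IH]; intros s' Hs'.
  - assert (Hs0 : is_series (fun k => (z * q ^ 0) ^ k / qpoch (c * q ^ 0) q k) s).
    { revert Hs. apply is_series_C_ext. intros k. simpl. now rewrite !Cmult_1_r. }
    assert (E := fine_term_step q c z s s' 0 Hq Hc Hz Hs0 Hs').
    rewrite sum_O. rewrite <- E.
    unfold fine_term. simpl. field.
  - destruct (geom_qpoch_series q (Rmax (Cmod c) (Cmod z)) Hq) as [M HM].
    { split; [|now apply Rmax_lub_lt].
      apply Rle_trans with (2 := Rmax_l _ _). apply Cmod_ge_0. }
    destruct (HM (c * q ^ S n) (z * q ^ S n)) as [t [Ht _]].
    { eapply Rle_trans; [now apply Cmod_mult_pow_le|apply Rmax_l]. }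
    { eapply Rle_trans; [now apply Cmod_mult_pow_le|apply Rmax_r]. }
    rewrite (IH t Ht), sum_Sn.
    rewrite (fine_term_step q c z t s' (S n) Hq Hc Hz Ht Hs').
    change plus with Cplus. ring.
Qed.

Lemma fine_term_le (q c z : C) :
  (Cmod q < 1)%R -> (Cmod c < 1)%R -> (Cmod z < 1)%R ->
  exists B : R, forall n, (Cmod (fine_term c q z n) <= B * Cmod (c * z) ^ n)%R.
Proof.
  intros Hq Hc Hz.
  destruct (inv_qpoch_bounded q (Rmax (Cmod c) (Cmod z)) Hq) as [B HB].
  { now apply Rmax_lub_lt. }
  exists (B * B)%R. intros n. unfold fine_term.
  assert (Hzn : (Cmod (z * q) <= Cmod z)%R).
  { rewrite <- (Cpow_1_r q). now apply Cmod_mult_pow_le. }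
  assert (H1 : qpoch c q n <> 0) by now apply qpoch_neq_0.
  assert (H2 : qpoch (z * q) q n <> 0).
  { apply qpoch_neq_0; [lra|exact Hq]. }
  replace (q ^ (n * (n - 1)) * (c * z) ^ n / (qpoch c q n * qpoch (z * q) q n))
    with ((/ qpoch c q n * / qpoch (z * q) q n) *
          ((c * z) ^ n * q ^ (n * (n - 1)))) by (field; auto).
  rewrite (Cmod_mult (_ * _)).
  apply Rmult_le_compat; try apply Cmod_ge_0.
  - rewrite Cmod_mult. apply Rmult_le_compat; try apply Cmod_ge_0; apply HB.
    + apply Rmax_l.
    + eapply Rle_trans; [exact Hzn|apply Rmax_r].
  - rewrite <- Cmod_pow. now apply Cmod_mult_pow_le.
Qed.

(** The remainder in [fine_partial_sum] is a [fine_term], of order |cz|^n, times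
    a factor bounded by 2M, so the partial sums converge to (1 - z) s. *)
Lemma rogers_fine_special (q c z : C) :
  (Cmod q < 1)%R -> (Cmod c < 1)%R -> (Cmod z < 1)%R ->
  exists s : C,
    is_series (fun k => z ^ k / qpoch c q k) s /\
    is_series (fine_term c q z) ((1 - z) * s).
Proof.
  intros Hq Hc Hz.
  destruct (geom_qpoch_series q (Rmax (Cmod c) (Cmod z)) Hq) as [M HM].
  { split; [|now apply Rmax_lub_lt].
    apply Rle_trans with (2 := Rmax_l _ _). apply Cmod_ge_0. }
  destruct (fine_term_le q c z Hq Hc Hz) as [B HB].
  destruct (HM c z (Rmax_l _ _) (Rmax_r _ _)) as [s [Hs _]].
  exists s. split; [exact Hs|].
  set (w := Cmod (c * z)).
  assert (Hw : (0 <= w < 1)%R).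
  { unfold w. split; [apply Cmod_ge_0|]. rewrite Cmod_mult.
    assert (H := Cmod_ge_0 c). assert (H' := Cmod_ge_0 z). nra. }
  apply is_series_of_remainder with (fun n => B * (2 * M) * w * w ^ n)%R.
  - intros n.
    destruct (HM (c * q ^ S n) (z * q ^ S n)) as [t [Ht Htb]].
    { eapply Rle_trans; [now apply Cmod_mult_pow_le|apply Rmax_l]. }
    { eapply Rle_trans; [now apply Cmod_mult_pow_le|apply Rmax_r]. }
    rewrite (fine_partial_sum q c z s t n Hq Hc Hz Hs Ht).
    set (X := sum_n _ _). set (Y := (_ * _)%C).
    replace (X - (X + Y)) with (- Y) by ring. rewrite Cmod_opp. unfold Y.
    rewrite Cmod_mult.
    replace (B * (2 * M) * w * w ^ n)%R with (B * w ^ S n * (2 * M))%R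
      by (simpl; ring).
    apply Rmult_le_compat; try apply Cmod_ge_0; [apply HB|].
    rewrite Cmod_mult.
    apply Rmult_le_compat; try apply Cmod_ge_0; [|exact Htb].
    assert (H1 := Cmod_triangle 1 (- (z * q ^ S n))).
    rewrite Cmod_1, Cmod_opp in H1.
    assert (H2 := Cmod_mult_pow_le z q (S n) Hq).
    unfold Cminus. lra.
  - replace (Finite 0) with (Rbar_mult (B * (2 * M) * w)%R 0)
      by (simpl; f_equal; ring).
    apply is_lim_seq_scal_l, is_lim_seq_geom. rewrite Rabs_pos_eq; lra.
Qed.

(** * Contiguous relations and Jackson's transformation *)

(** The terms of 2phi1(a, 0; c; q, z). *)
Definition phi_term (a c q z : C) (n : nat) : C :=
  qpoch a q n / (qpoch q q n * qpoch c q n) * z ^ n.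

Definition jackson_term (a c q z : C) (n : nat) : C :=
  qpoch a q n / (qpoch q q n * qpoch c q n)
  * (q ^ (n * (n - 1)) * (c * z) ^ n / qpoch (a * z) q n).

(** (a;q)_(n+1), factored from either end. *)
Lemma qpoch_mult_q (a q : C) (n : nat) :
  1 - a <> 0 -> qpoch (a * q) q n = qpoch a q n * (1 - a * q ^ n) / (1 - a).
Proof.
  intros Ha.
  change (qpoch a q n * (1 - a * q ^ n)) with (qpoch a q (S n)).
  rewrite qpoch_shift. now field.
Qed.

(** Termwise, passing from (a)_n to (aq)_n multiplies by (1 - a q^n)/(1 - a), and
    replacing z by zq multiplies by q^n. *)
Lemma phi_term_contiguous (a c q z : C) (n : nat) :
  1 - a <> 0 ->
  phi_term (a * q) c q z n
  = / (1 - a) * (phi_term a c q z n - a * phi_term a c q (z * q) n).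
Proof.
  intros Ha. unfold phi_term.
  rewrite (qpoch_mult_q a q n Ha), Cpow_mult_l. unfold Cdiv.
  generalize (/ (qpoch q q n * qpoch c q n)) as D. intros D. field. exact Ha.
Qed.

(** The factors 1 - az and 1 - z come from the prefactors (z)_l of the
    transformation at (aq, z), (a, z) and (a, zq).  Over the common denominator
    (azq)_n the relation reduces to
    [(1 - a z q^n) - a q^n (1 - z) = 1 - a q^n]. *)
Lemma jackson_term_contiguous (a c q z : C) (n : nat) :
  (Cmod q < 1)%R -> 1 - a <> 0 -> (Cmod (a * z) < 1)%R ->
  jackson_term (a * q) c q z n
  = / (1 - a) * ((1 - a * z) * jackson_term a c q z n
                 - a * (1 - z) * jackson_term a c q (z * q) n).
Proof.
  intros Hq Ha Haz. unfold jackson_term.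
  assert (H0 := one_minus_neq_0 _ Haz).
  assert (Hn : 1 - a * z * q ^ n <> 0).
  { apply one_minus_neq_0, Rle_lt_trans with (2 := Haz).
    now apply Cmod_mult_pow_le. }
  assert (Hp := qpoch_neq_0 (a * z) q n Haz Hq).
  replace (a * q * z) with (a * z * q) by ring.
  replace (a * (z * q)) with (a * z * q) by ring.
  replace (c * (z * q)) with (c * z * q) by ring.
  rewrite (qpoch_mult_q a q n Ha), (qpoch_mult_q (a * z) q n H0).
  rewrite (Cpow_mult_l (c * z) q).
  unfold Cdiv.
  generalize (/ (qpoch q q n * qpoch c q n)) as D. intros D.
  field. repeat split; auto.
Qed.

(** The exponent starts at 1 because the contiguous relation divides by 1 - a,
    which vanishes at a = q^0; hence the base case is a = q. *)
Lemma jackson_transformation (q c : C) (l : nat) :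
  (Cmod q < 1)%R -> (Cmod c < 1)%R ->
  forall z : C, (Cmod z < 1)%R ->
  exists s : C,
    is_series (phi_term (q ^ S l) c q z) s /\
    is_series (jackson_term (q ^ S l) c q z) (qpoch z q (S l) * s).
Proof.
  intros Hq Hc. induction l as [|l IH]; intros z Hz.
  - destruct (rogers_fine_special q c z Hq Hc Hz) as [s [H1 H2]].
    exists s. split.
    + revert H1. apply is_series_C_ext. intros n. unfold phi_term.
      rewrite Cpow_1_r.
      assert (A := qpoch_neq_0 q q n Hq Hq).
      assert (A' := qpoch_neq_0 c q n Hc Hq). field. auto.
    + replace (qpoch z q 1 * s) with ((1 - z) * s) by (simpl; ring).
      revert H2. apply is_series_C_ext. intros n. unfold fine_term, jackson_term.
      rewrite Cpow_1_r, (Cmult_comm z q).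
      assert (Hqz : (Cmod (q * z) < 1)%R).
      { apply Rle_lt_trans with (2 := Hq).
        rewrite <- (Cpow_1_r z). now apply Cmod_mult_pow_le. }
      assert (A := qpoch_neq_0 q q n Hq Hq).
      assert (A' := qpoch_neq_0 c q n Hc Hq).
      assert (A'' := qpoch_neq_0 (q * z) q n Hqz Hq). field. auto.
  - assert (Hzq : (Cmod (z * q) < 1)%R).
    { apply Rle_lt_trans with (2 := Hz).
      rewrite <- (Cpow_1_r q). now apply Cmod_mult_pow_le. }
    destruct (IH z Hz) as [s [Hs Hj]].
    destruct (IH (z * q) Hzq) as [t [Ht Hk]].
    assert (Ha' := Cmod_pow_lt_1 q l Hq).
    set (a := q ^ S l) in *.
    assert (Ha : 1 - a <> 0) by now apply one_minus_neq_0.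
    assert (Haz : (Cmod (a * z) < 1)%R).
    { rewrite Cmult_comm. apply Rle_lt_trans with (2 := Hz).
      now apply Cmod_mult_pow_le. }
    replace (q ^ S (S l)) with (a * q) by (unfold a; simpl; ring).
    exists (/ (1 - a) * (s - a * t)). split.
    + apply (is_series_C_ext (fun n => / (1 - a) *
        (phi_term a c q z n - a * phi_term a c q (z * q) n))).
      { intros n. symmetry. now apply phi_term_contiguous. }
      apply (is_series_scal (V := C_NormedModule)).
      apply (is_series_minus (V := C_NormedModule)); [exact Hs|].
      now apply (is_series_scal (V := C_NormedModule)).
    + apply (is_series_C_ext (fun n => / (1 - a) *
        ((1 - a * z) * jackson_term a c q z n
         - a * (1 - z) * jackson_term a c q (z * q) n))).
      { intros n. symmetry. now apply jackson_term_contiguous. }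
      replace (qpoch z q (S (S l)) * (/ (1 - a) * (s - a * t)))
        with (/ (1 - a) * ((1 - a * z) * (qpoch z q (S l) * s)
                - a * (1 - z) * (qpoch (z * q) q (S l) * t))).
      * apply (is_series_scal (V := C_NormedModule)).
        apply (is_series_minus (V := C_NormedModule));
          now apply (is_series_scal (V := C_NormedModule)).
      * assert (E1 : qpoch z q (S (S l)) = (1 - z) * qpoch (z * q) q (S l))
          by apply qpoch_shift.
        assert (E2 : qpoch z q (S (S l)) = qpoch z q (S l) * (1 - a * z)).
        { unfold a. rewrite (Cmult_comm _ z). reflexivity. }
        transitivity (/ (1 - a) * ((qpoch z q (S l) * (1 - a * z)) * s
                - a * ((1 - z) * qpoch (z * q) q (S l)) * t)); [ring|].
        rewrite <- E1, <- E2. ring.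
Qed.

(** * Specialization to c = z = q^(l+1) *)

Lemma double_binomial_2 (l : nat) : (2 * binomial.binomial l 2 + l = l * l)%nat.
Proof.
  induction l as [|l IH]; [reflexivity|].
  rewrite binomial.binS, binomial.bin1.
  change (ssrnat.addn ?a ?b) with (a + b)%nat. lia.
Qed.

Lemma lhs_exponent (l k : nat) :
  (binomial.binomial l 2 + (l + 1) * (l + k)
   = (3 * l ^ 2 + l) / 2 + (l + 1) * k)%nat.
Proof.
  assert (H := double_binomial_2 l).
  replace (3 * l ^ 2 + l)%nat
    with ((binomial.binomial l 2 + (l + 1) * l) * 2)%nat by (simpl; nia).
  rewrite Nat.div_mul; lia.
Qed.

Lemma phi_term_specialised (q : C) (l n : nat) :
  (Cmod q < 1)%R ->
  phi_term (q ^ S l) (q ^ S l * q) q (q ^ S l * q) n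
  = (1 - q ^ S l) * (q ^ ((S l + 1) * n) / (qpoch q q n * (1 - q ^ (S l + n)))).
Proof.
  intros Hq. unfold phi_term.
  assert (Ha' := Cmod_pow_lt_1 q l Hq).
  assert (Hn : 1 - q ^ S l * q ^ n <> 0).
  { apply one_minus_neq_0, Rle_lt_trans with (2 := Ha').
    now apply Cmod_mult_pow_le. }
  assert (Ha := one_minus_neq_0 _ Ha').
  assert (A := qpoch_neq_0 q q n Hq Hq).
  assert (A' := qpoch_neq_0 (q ^ S l) q n Ha' Hq).
  rewrite (qpoch_mult_q _ q n Ha), Cpow_add_r, Cpow_mult_r.
  rewrite (Cpow_add_r q (S l) 1), Cpow_1_r.
  field. auto.
Qed.

Lemma jackson_term_specialised (q : C) (l n : nat) :
  (Cmod q < 1)%R ->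
  jackson_term (q ^ S l) (q ^ S l * q) q (q ^ S l * q) n
  = qpoch q q (2 * S l) *
    (q ^ ((2 * S l + 1) * n + n ^ 2) * (1 - q ^ S l)
     / (qpoch q q n * qpoch q q (n + 2 * S l) * (1 - q ^ (n + S l)))).
Proof.
  intros Hq. unfold jackson_term.
  assert (Ha' := Cmod_pow_lt_1 q l Hq).
  assert (Hn : 1 - q ^ S l * q ^ n <> 0).
  { apply one_minus_neq_0, Rle_lt_trans with (2 := Ha').
    now apply Cmod_mult_pow_le. }
  assert (Ha := one_minus_neq_0 _ Ha').
  assert (A := qpoch_neq_0 q q n Hq Hq).
  assert (A' := qpoch_neq_0 (q ^ S l) q n Ha' Hq).
  rewrite (Nat.add_comm n (2 * S l)), (Nat.add_comm n (S l)), qpoch_add.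
  rewrite (Cpow_add_r q (S l) n).
  replace (q ^ S l * (q ^ S l * q)) with (q * q ^ (2 * S l)).
  2:{ replace (2 * S l)%nat with (S l + S l)%nat by lia.
      rewrite Cpow_add_r. ring. }
  assert (B : qpoch (q * q ^ (2 * S l)) q n <> 0).
  { apply qpoch_neq_0; [|exact Hq]. apply Rle_lt_trans with (2 := Hq).
    now apply Cmod_mult_pow_le. }
  assert (B' := qpoch_neq_0 q q (2 * S l) Hq Hq).
  replace (q ^ (n * (n - 1)) * (q ^ S l * q * (q ^ S l * q)) ^ n)
    with (q ^ ((2 * S l + 1) * n + n ^ 2)).
  2:{ replace (q ^ S l * q * (q ^ S l * q)) with (q ^ (S l + 1 + (S l + 1)))
        by (rewrite !Cpow_add_r, !Cpow_1_r; ring).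
      rewrite <- Cpow_mult_r, <- Cpow_add_r. f_equal.
      destruct n; [simpl; lia|]. rewrite Nat.sub_1_r. simpl. nia. }
  rewrite (qpoch_mult_q _ q n Ha).
  field. repeat split; auto.
Qed.

Lemma lhs_term (q : C) (l k : nat) :
  (Cmod q < 1)%R ->
  q ^ (binomial.binomial (S l) 2 + (S l + 1) * (S l + k)) / qpoch q q (S l + k)
    * gauss_binom q (S l + k - 1) (S l - 1)
  = q ^ ((3 * S l ^ 2 + S l) / 2) / qpoch q q (S l) *
    phi_term (q ^ S l) (q ^ S l * q) q (q ^ S l * q) k.
Proof.
  intros Hq. rewrite (phi_term_specialised q l k Hq), lhs_exponent, Cpow_add_r.
  unfold gauss_binom.
  replace (S l + k - 1)%nat with (l + k)%nat by lia.
  replace (S l - 1)%nat with l by lia.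
  destruct (Nat.leb_spec l (l + k)) as [_|H]; [|lia].
  replace (l + k - l)%nat with k by lia.
  change (qpoch q q (S l + k)) with (qpoch q q (l + k) * (1 - q * q ^ (l + k))).
  change (qpoch q q (S l)) with (qpoch q q l * (1 - q ^ S l)).
  change (q * q ^ (l + k)) with (q ^ (S l + k)).
  assert (A1 := qpoch_neq_0 q q l Hq Hq).
  assert (A2 := qpoch_neq_0 q q k Hq Hq).
  assert (A3 := qpoch_neq_0 q q (l + k) Hq Hq).
  assert (A4 := one_minus_neq_0 _ (Cmod_pow_lt_1 q l Hq)).
  assert (A5 := one_minus_neq_0 _ (Cmod_pow_lt_1 q (l + k) Hq)).
  change (S (l + k)) with (S l + k)%nat in A5.
  field. auto.
Qed.

(* Both series converge, and the left-hand one sums to the prefactor times the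
   right-hand one.  The division by 2 in nat is exact: 3 l^2 + l is even. *)
Theorem theorem4p1 :
  forall (l : nat) (q : C), (1 <= l)%nat -> (Cmod q < 1)%R ->
  exists s : C,
    is_series
      (fun n : nat =>
         q ^ ((2 * l + 1) * n + n ^ 2) * (1 - q ^ l)
         / (qpoch q q n * qpoch q q (n + 2 * l) * (1 - q ^ (n + l)))) s
    /\ is_series_from l
      (fun n : nat =>
         q ^ (binomial.binomial l 2 + (l + 1) * n) / qpoch q q n
         * gauss_binom q (n - 1) (l - 1))
      (q ^ ((3 * l ^ 2 + l) / 2) * s).
Proof.
  intros l q Hl Hq. destruct l as [|l]; [lia|]. clear Hl.
  set (z := q ^ S l * q).
  assert (Hz : (Cmod z < 1)%R).
  { unfold z. rewrite Cmult_comm. exact (Cmod_pow_lt_1 q (S l) Hq). }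
  destruct (jackson_transformation q z l Hq Hz z Hz) as [s [Hs Hj]].
  assert (A1 := qpoch_neq_0 q q (S l) Hq Hq).
  assert (A2 := qpoch_neq_0 q q (2 * S l) Hq Hq).
  (* The prefactor (z)_l of the transformation is what turns 1/(q)_(2l) on the
     right into 1/(q)_l on the left. *)
  assert (E : qpoch q q (2 * S l) = qpoch q q (S l) * qpoch z q (S l)).
  { replace (2 * S l)%nat with (S l + S l)%nat by lia.
    rewrite qpoch_add, (Cmult_comm q). reflexivity. }
  exists (s / qpoch q q (S l)). split.
  - replace (s / qpoch q q (S l))
      with (/ qpoch q q (2 * S l) * (qpoch z q (S l) * s)).
    2:{ rewrite E. assert (A3 := qpoch_neq_0 z q (S l) Hz Hq). field. auto. }
    apply (is_series_C_ext (fun n => / qpoch q q (2 * S l) *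
             jackson_term (q ^ S l) z q z n)).
    { intros n. unfold z. rewrite (jackson_term_specialised q l n Hq).
      rewrite Cmult_assoc, Cinv_l by exact A2. now rewrite Cmult_1_l. }
    now apply (is_series_scal (V := C_NormedModule)).
  - replace (q ^ ((3 * S l ^ 2 + S l) / 2) * (s / qpoch q q (S l)))
      with (q ^ ((3 * S l ^ 2 + S l) / 2) / qpoch q q (S l) * s)
      by (field; exact A1).
    apply (is_series_C_ext (fun n =>
             q ^ ((3 * S l ^ 2 + S l) / 2) / qpoch q q (S l) *
             phi_term (q ^ S l) z q z n)).
    { intros n. symmetry. exact (lhs_term q l n Hq). }
    now apply (is_series_scal (V := C_NormedModule)).
Qed.
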